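(* Let $F=\{f_1,\dots,f_n\}$ be a family of contracting similitudes of $\mathbb{R}^l$, all having the same contraction ratio $c\in(0,1)$, which satisfies the open set condition, and let $K$ be its attractor. For $k\ge1$ let $A_k$ be the set of sequences $(i_1,\dots,i_k)\in\{1,\dots,n\}^k$ such that $f_{i_1}f_{i_2}\cdots f_{i_k}(K)\cap\partial K\neq\emptyset$, and let $\alpha=\lim_{k\to\infty}|A_k|^{1/k}$. Then $$\dim_H\partial K=-\frac{\ln\alpha}{\ln c}.$$
   Context: A contracting similitude of ratio $c_i\in(0,1)$ is a map $f_i:\mathbb{R}^l\to\mathbb{R}^l$ with $|f_i(x)-f_i(y)|=c_i|x-y|$ for all $x,y$. The attractor $K$ of $F$ is the unique nonempty compact set with $K=\bigcup_{i=1}^nf_i(K)$. $F$ satisfies the open set condition if there is a bounded nonempty open set $U$ with $\bigcup_{i=1}^n f_i(U)\subset U$ and $f_i(U)\cap f_j(U)=\emptyset$ for $i\ne j$. $\partial K$ is the topological boundary of $K$ in $\mathbb{R}^l$, $\dim_H$ is Hausdorff dimension, $|\cdot|$ of a set is cardinality, and juxtaposition of maps is composition. *)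

(* Defs.v *)
From HB Require Import structures.
From mathcomp Require Import all_boot all_order all_algebra.
From mathcomp Require Import all_classical all_reals all_analysis.

Set Implicit Arguments.
Unset Strict Implicit.
Unset Printing Implicit Defensive.

Import Order.TTheory GRing.Theory Num.Theory.
Import numFieldNormedType.Exports.

Local Open Scope classical_set_scope.
Local Open Scope ring_scope.

(* The library norm on 'rV[R]_l is the sup norm: it yields the usual topology
   and the usual bounded sets of R^l, but not the Euclidean metric, which
   similitudes and diameters are about. *)
Definition enorm (R : realType) (l : nat) (x : 'rV[R]_l) : R :=
  Num.sqrt (\sum_(i < l) x ord0 i ^+ 2).

Definition similitude (R : realType) (l : nat) (c : R)
    (f : 'rV[R]_l -> 'rV[R]_l) : Prop :=
  forall x y, enorm (f x - f y) = c * enorm (x - y).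

Definition boundary (T : topologicalType) (A : set T) : set T :=
  closure A `\` interior A.

Definition open_set_condition (R : realType) (l n : nat)
    (f : 'I_n -> 'rV[R]_l -> 'rV[R]_l) : Prop :=
  exists U : set 'rV[R]_l,
    [/\ open U, bounded_set U, U !=set0,
        \bigcup_i (f i @` U) `<=` U &
        forall i j, i != j -> (f i @` U) `&` (f j @` U) = set0].

Definition is_attractor (R : realType) (l n : nat)
    (f : 'I_n -> 'rV[R]_l -> 'rV[R]_l) (K : set 'rV[R]_l) : Prop :=
  [/\ compact K, K !=set0 & K = \bigcup_i (f i @` K)].

(* 0 is added to the set of distances so that the diameter of set0 is 0 *)
Definition diam (R : realType) (l : nat) (E : set 'rV[R]_l) : \bar R :=
  ereal_sup (0%:E |` [set (enorm (p.1 - p.2))%:E | p in E `*` E]).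

Definition hausdorff_cover (R : realType) (l : nat) (delta : R)
    (A : set 'rV[R]_l) (E : nat -> set 'rV[R]_l) : Prop :=
  A `<=` \bigcup_j E j /\ forall j, (diam (E j) <= delta%:E)%E.

(* diam(E)^s, with the convention that set0 has weight 0 even for s = 0, where
   0 `^ 0 = 1. Hence finite covers are sequences padded with set0. *)
Definition hausdorff_weight (R : realType) (l : nat) (s : R)
    (E : set 'rV[R]_l) : \bar R :=
  if pselect (E = set0) then 0%E else (diam E `^ s)%E.

Definition hausdorff_premeasure (R : realType) (l : nat) (s delta : R)
    (A : set 'rV[R]_l) : \bar R :=
  ereal_inf [set (\sum_(0 <= j <oo) hausdorff_weight s (E j))%E
            | E in hausdorff_cover delta A].

Definition hausdorff_measure (R : realType) (l : nat) (s : R)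
    (A : set 'rV[R]_l) : \bar R :=
  ereal_sup [set hausdorff_premeasure s delta A
            | delta in [set delta : R | 0 < delta]].

Definition hausdorff_dim (R : realType) (l : nat) (A : set 'rV[R]_l) : \bar R :=
  ereal_inf [set s%:E | s in
    [set s : R | 0 <= s /\ hausdorff_measure s A = 0%E]].

(* word_map f [:: i1; ...; ik] x = f i1 (f i2 (... (f ik x))) *)
Definition word_map (T : Type) (n : nat) (f : 'I_n -> T -> T) (w : seq 'I_n)
    (x : T) : T := foldr f x w.

Definition boundary_words (R : realType) (l n : nat)
    (f : 'I_n -> 'rV[R]_l -> 'rV[R]_l) (K : set 'rV[R]_l) (k : nat) :
    {set k.-tuple 'I_n} :=
  [set w : k.-tuple 'I_n |
    `[< (word_map f w @` K) `&` boundary K !=set0 >]]%SET.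

(* The term of index 0 is irrelevant to the limit. *)
Definition boundary_growth (R : realType) (l n : nat)
    (f : 'I_n -> 'rV[R]_l -> 'rV[R]_l) (K : set 'rV[R]_l) (k : nat) : R :=
  #|boundary_words f K k|%:R `^ (k%:R)^-1.

(* Main.v *)
Require Import Defs.
From mathcomp Require Import all_boot all_order all_algebra.
From mathcomp Require Import all_classical all_reals all_analysis.
From mathcomp Require Import finmap ring lra.
Import Order.TTheory GRing.Theory Num.Theory.
Import numFieldNormedType.Exports.
Local Open Scope classical_set_scope.
Local Open Scope ring_scope.
(* Write a_k = |A_k|.  If f_w(x) lies on the boundary of K with x in K, then x
   lies on it too, so A_(j+k) embeds in A_j x A_k and Fekete's lemma gives
   ln a_k / k --> L = ln alpha.  The sets f_w(K), w in A_k, cover the boundary by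
   a_k sets of diameter O(c^k), whence dim <= -L / ln c.
   For the other inequality no measure is needed (Furstenberg's argument for
   subshifts): if the s-dimensional measure of the boundary is 0, compactness
   gives finitely many balls of radii r_b covering it with sum r_b^s tiny.  By the
   open set condition a ball of radius at most c^(k_b) meets at most N pieces
   f_u(K) with |u| = k_b.  Cutting off such a prefix u from a long boundary word
   leaves a boundary word, hence a_k <= N sum_b a_(k - k_b) while
   N sum_b c^(s k_b) <= 1, and therefore a_k = O(c^(-s k)), that is
   L <= -s ln c. *)

Set Implicit Arguments.
Unset Strict Implicit.

(** * Euclidean similitudes *)

Section EuclideanNorm.
Variables (R : realType) (l : nat).
Implicit Types (x y : 'rV[R]_l) (g : 'rV[R]_l -> 'rV[R]_l) (c e : R).

Lemma sum_sqr_ge0 x : 0 <= \sum_(i < l) x ord0 i ^+ 2.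
Proof. by apply: sumr_ge0 => i _; apply: sqr_ge0. Qed.

Lemma enorm_ge0 x : 0 <= enorm x.
Proof. exact: sqrtr_ge0. Qed.

Lemma enorm_sqr x : enorm x ^+ 2 = \sum_(i < l) x ord0 i ^+ 2.
Proof. by rewrite sqr_sqrtr // sum_sqr_ge0. Qed.

Lemma enorm0 : enorm (0 : 'rV[R]_l) = 0.
Proof. by rewrite /enorm big1 ?sqrtr0 // => i _; rewrite mxE expr0n. Qed.

Lemma mx_norm_le x b : 0 <= b -> (forall i, `|x ord0 i| <= b) -> `|x| <= b.
Proof.
move=> b0 h; rewrite /Num.Def.normr /= mx_normrE; apply: bigmax_le => //= -[i j] _ /=.
by rewrite ord1.
Qed.

Lemma mx_norm_lt x b : 0 < b -> (forall i, `|x ord0 i| < b) -> `|x| < b.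
Proof.
move=> b0 h; rewrite /Num.Def.normr /= mx_normrE; apply: bigmax_lt => //= -[i j] _ /=.
by rewrite ord1.
Qed.

Lemma coord_le_mx_norm x i : `|x ord0 i| <= `|x|.
Proof.
rewrite [leRHS]/Num.Def.normr /= mx_normrE.
exact: (le_bigmax _ (fun ij : 'I_1 * 'I_l => `|x ij.1 ij.2|) (ord0, i)).
Qed.

Lemma coord_le_enorm x i : `|x ord0 i| <= enorm x.
Proof.
rewrite -sqrtr_sqr /enorm ler_wsqrtr // (bigD1 i) //= lerDl.
by apply: sumr_ge0 => j _; apply: sqr_ge0.
Qed.

Lemma mx_norm_le_enorm x : `|x| <= enorm x.
Proof. exact/mx_norm_le/coord_le_enorm/enorm_ge0. Qed.

(** The factor [l.+1], cruder than the square root of [l], is positive even for [l = 0], so radii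
    can be divided by it. *)
Lemma enorm_le_mx_norm x : enorm x <= l.+1%:R * `|x|.
Proof.
rewrite -[leRHS]ger0_norm ?mulr_ge0 // -sqrtr_sqr ler_wsqrtr //.
apply: (@le_trans _ _ (\sum_(i < l) `|x| ^+ 2)).
  apply: ler_sum => i _; rewrite -(@real_normK _ (x ord0 i)) ?num_real //.
  by rewrite ler_pXn2r ?nnegrE // coord_le_mx_norm.
rewrite sumr_const card_ord exprMn -[leLHS]mulr_natl ler_wpM2r ?sqr_ge0 //.
by rewrite -natrX ler_nat (leq_trans (leqnSn l)) // -[leqLHS]expn1 leq_pexp2l.
Qed.

Lemma similitude_inj g c : 0 < c -> similitude c g -> injective g.
Proof.
move=> c0 hg x y gxy; apply/eqP; rewrite -subr_eq0 -normr_le0.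
apply: (le_trans (mx_norm_le_enorm _)).
by rewrite -(pmulr_rle0 _ c0) -hg gxy subrr enorm0.
Qed.

(* By polarization a similitude fixing the origin multiplies inner products by
   c^2, so the images of the standard basis, divided by c, are the rows of an
   orthogonal matrix Q, and the similitude is c Q. *)
Lemma similitude_surj g c : 0 < c -> similitude c g ->
  forall y, exists x, g x = y.
Proof.
move=> c0 hg y.
pose h x : 'rV[R]_l := c^-1 *: (g x - g 0).
have hB x z : \sum_(i < l) (h x ord0 i - h z ord0 i) ^+ 2
    = \sum_(i < l) (x ord0 i - z ord0 i) ^+ 2.
  transitivity ((c^-1 * enorm (g x - g z)) ^+ 2).
    rewrite exprMn enorm_sqr mulr_sumr; apply: eq_bigr => i _.
    by rewrite !mxE; ring.
  rewrite hg mulKf ?gt_eqF // enorm_sqr; apply: eq_bigr => i _.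
  by rewrite !mxE.
have h0 i : h 0 ord0 i = 0 by rewrite !mxE subrr mulr0.
have hn x : \sum_(i < l) h x ord0 i ^+ 2 = \sum_(i < l) x ord0 i ^+ 2.
  have := hB x 0; under eq_bigr do rewrite h0 subr0.
  by move=> ->; apply: eq_bigr => i _; rewrite !mxE subr0.
have hdot x z : \sum_(i < l) h x ord0 i * h z ord0 i
    = \sum_(i < l) x ord0 i * z ord0 i.
  have polar (u v : 'rV[R]_l) : \sum_(i < l) u ord0 i * v ord0 i
      = 2^-1 * (\sum_(i < l) u ord0 i ^+ 2 + \sum_(i < l) v ord0 i ^+ 2
               - \sum_(i < l) (u ord0 i - v ord0 i) ^+ 2) :> R.
    rewrite -big_split /= -sumrB mulr_sumr; apply: eq_bigr => i _.
    by field.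
  by rewrite (polar (h x)) (polar x) hB !hn.
pose Q : 'M[R]_l := \matrix_(i, j) h (delta_mx 0 i) ord0 j.
(* The coordinates of [h x *m Q^T] are the inner products of [h x] with the images of the basis
   vectors, hence those of [x] with the basis itself. *)
have hQ x : h x *m Q^T = x.
  apply/rowP => j; rewrite mxE.
  transitivity (\sum_(i < l) h x ord0 i * h (delta_mx 0 j) ord0 i).
    by apply: eq_bigr => i _; rewrite [Q^T _ _]mxE [Q _ _]mxE.
  rewrite hdot (bigD1 j) //= !mxE !eqxx mulr1 big1 ?addr0 // => i ij.
  by rewrite mxE eqxx (negbTE ij) mulr0.
have QQ : Q *m Q^T = 1%:M.
  apply/row_matrixP => i; rewrite row_mul row1 -[RHS]hQ; congr (_ *m _).
  by apply/rowP => j; rewrite !mxE.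
have QQ' := mulmx1C QQ.
exists ((c^-1 *: (y - g 0)) *m Q^T).
set x := (X in g X = _).
(* By [hQ] and [QQ'], [h] is right multiplication by [Q], which cancels the factor [Q^T] in [x]. *)
have : h x = c^-1 *: (y - g 0).
  by rewrite -[LHS]mulmx1 -QQ' mulmxA hQ -mulmxA QQ' mulmx1.
by move/(scalerI (invr_neq0 (lt0r_neq0 c0)))/addIr.
Qed.

(** By surjectivity every point near [g x] is some [g z]; since [g] scales distances exactly by [c],
    this [z] is near [x] and so lies in [K]. *)
Lemma similitude_interior g c K : 0 < c -> similitude c g ->
  g @` K `<=` K -> g @` (interior K) `<=` interior K.
Proof.
move=> c0 hg gK _ [x Kx <-]; move: Kx; rewrite /interior /= !nbhs_ballP.
move=> [e /= e0 xK]; exists (c * (e / l.+1%:R)) => /=.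
  by rewrite mulr_gt0 // divr_gt0.
move=> y; rewrite -ball_normE /= => gxy.
have [z zy] := similitude_surj c0 hg y.
rewrite -zy; apply: gK; exists z => //; apply: xK; rewrite -ball_normE /=.
apply: (le_lt_trans (mx_norm_le_enorm _)); rewrite -(ltr_pM2l c0) -hg zy.
apply: (le_lt_trans (enorm_le_mx_norm _)).
by rewrite mulrC -ltr_pdivlMr // -mulrA.
Qed.

End EuclideanNorm.

(** * Words and composed maps *)

Section Words.
Variable n : nat.
Lemma tuple_catP j m (w : (j + m).-tuple 'I_n) :
  exists u : j.-tuple 'I_n, exists v : m.-tuple 'I_n, w = [tuple of u ++ v].
Proof.
have su : size (take j w) == j by rewrite size_takel // size_tuple leq_addr.
have sv : size (drop j w) == m by rewrite size_drop size_tuple addKn.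
by exists (Tuple su), (Tuple sv); apply: val_inj; rewrite /= cat_take_drop.
Qed.

(** Concatenation maps [B] x [C] onto a set containing [A]. This serves both submultiplicativity and
    the cutting of prefixes near a ball. *)
Lemma card_words_cat j m (A : {set (j + m).-tuple 'I_n})
    (B : {set j.-tuple 'I_n}) (C : {set m.-tuple 'I_n}) :
  (forall (u : j.-tuple 'I_n) (v : m.-tuple 'I_n),
     [tuple of u ++ v] \in A -> u \in B /\ v \in C) ->
  (#|A| <= #|B| * #|C|)%N.
Proof.
move=> ABC; rewrite -cardsX.
apply: leq_trans (leq_imset_card
  (fun p : j.-tuple 'I_n * m.-tuple 'I_n => [tuple of p.1 ++ p.2]) _).
apply/subset_leq_card/fintype.subsetP => w wA; have [u [v wE]] := tuple_catP w.
apply/imsetP; exists (u, v) => //; rewrite inE /=.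
by apply/andP; apply: ABC; rewrite -wE.
Qed.

End Words.

Section WordMaps.
Variables (T : Type) (n : nat) (f : 'I_n -> T -> T).
Implicit Types (u v w : seq 'I_n) (A U K : set T).

Lemma word_map_cat u v x : word_map f (u ++ v) x = word_map f u (word_map f v x).
Proof. by rewrite /word_map foldr_cat. Qed.

Lemma word_map_sub A w : \bigcup_i (f i @` A) `<=` A -> word_map f w @` A `<=` A.
Proof.
move=> fA _ [x Ax <-]; elim: w => //= i w IHw.
by apply: fA; exists i => //; exists (word_map f w x).
Qed.

Lemma word_map_cover K k : K = \bigcup_i (f i @` K) ->
  forall x, K x -> exists w : k.-tuple 'I_n, (word_map f w @` K) x.
Proof.
move=> KE; elim: k => [|k IHk] x Kx; first by exists [tuple]; exists x.
move: Kx; rewrite {1}KE => -[i _ [y Ky <-]].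
have [w [z Kz <-]] := IHk y Ky.
by exists (cons_tuple i w); exists z.
Qed.

(** Equal first letters cancel by injectivity; at the first place where the letters [i] and [j]
    differ, the common value would lie in both images of [U]. *)
Lemma word_map_disjoint U : (forall i, injective (f i)) ->
  \bigcup_i (f i @` U) `<=` U ->
  (forall i j, i != j -> (f i @` U) `&` (f j @` U) = set0) ->
  forall u v x y, size u = size v -> U x -> U y ->
    word_map f u x = word_map f v y -> u = v.
Proof.
move=> finj fU fdis; elim=> [|i u IHu] [|j v] x y //= [suv] Ux Uy uv.
have [ij|ij] := eqVneq i j.
  by rewrite -ij in uv *; congr cons; apply: IHu Ux Uy _ => //; apply: finj uv.
have Uw w z : U z -> U (word_map f w z).
  by move=> Uz; apply: (word_map_sub fU); exists z.
suff : ((f i @` U) `&` (f j @` U)) (f i (word_map f u x)) by rewrite fdis.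
by split; [exists (word_map f u x) | rewrite uv; exists (word_map f v y)];
  rewrite //; apply: Uw.
Qed.

End WordMaps.

Lemma word_map_similitude (R : realType) (l n : nat) (c : R)
    (f : 'I_n -> 'rV[R]_l -> 'rV[R]_l) w :
  (forall i, similitude c (f i)) -> similitude (c ^+ size w) (word_map f w).
Proof.
move=> hf; elim: w => [|i w IHw] x y /=; first by rewrite expr0 mul1r.
by rewrite hf IHw exprS mulrA.
Qed.

(** * Subadditive and renewal sequences *)

Section RealSequences.
Variable R : realType.

(* Write k = q m + r with r < m: then u k <= q u m + max_(r < m) u r. *)
Lemma fekete (u : nat -> R) : (forall k, 0 <= u k) ->
  (forall j k, u (j + k)%N <= u j + u k) ->
  exists L : R, u k / k%:R @[k --> \oo] --> L.
Proof.
move=> u0 usub.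
pose S := [set u k.+1 / k.+1%:R | k in [set: nat]].
have Sinf : has_inf S.
  split; first by exists (u 1%N / 1%:R), 0%N.
  by exists 0 => _ [k _ <-]; rewrite divr_ge0.
exists (inf S); apply/cvgrPdist_lt => e e0.
have [_ [m _ <-] hm] := inf_adherent e0 Sinf.
set M := m.+1 in hm.
(* All terms being nonnegative, [B] dominates each remainder term [u r] with [r < M]. *)
pose B := \sum_(r < M) u r.
have uB k : u k <= (k %/ M)%:R * u M + B.
  rewrite {1}(divn_eq k M) mulnC.
  have -> : (k %/ M)%:R * u M + B = u M *+ (k %/ M) + B by rewrite mulr_natl.
  elim: (k %/ M)%N => [|q IHq].
    rewrite muln0 add0n mulr0n add0r /B.
    rewrite (bigD1 (Ordinal (ltn_pmod k (ltn0Sn m)))) //= lerDl.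
    exact: sumr_ge0.
  rewrite mulnS -addnA mulrS -addrA; apply: le_trans (usub _ _) _.
  by rewrite lerD2l.
(* The slack left by the choice of [M]; it absorbs [B / k] as soon as [k > B / d]. *)
pose d := inf S + e - u M / M%:R.
have d0 : 0 < d by rewrite subr_gt0.
near=> k.
have k0 : (0 < k)%N by near: k; exact: nbhs_infty_gt.
have k0' : 0 < k%:R :> R by rewrite ltr0n.
have lo : inf S <= u k / k%:R.
  by apply: ge_inf; [case: Sinf | exists k.-1; rewrite ?prednK].
rewrite ler0_norm ?subr_le0 // opprB ltrBlDl.
have kB : B / d < k%:R by near: k; exact: nbhs_infty_gtr.
rewrite ltr_pdivrMr //; apply: le_lt_trans (uB k) _.
have -> : (inf S + e) * k%:R = u M / M%:R * k%:R + d * k%:R by rewrite /d; ring.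
apply: ler_ltD; last by rewrite mulrC -ltr_pdivrMr.
rewrite mulrAC -mulrA mulrC ler_wpM2l // ler_pdivlMr // -natrM ler_nat.
exact: leq_trunc_div.
Unshelve. all: by end_near. Qed.

(* With b k = a k * t^k the recursion reads b k <= max_(i < k) b i. *)
Lemma renewal_bound (a : nat -> R) (N t : R) (s : seq nat) :
  (forall k, 0 <= a k) -> 0 <= N -> 0 < t -> all (leq 1) s ->
  N * (\sum_(j <- s) t ^+ j) <= 1 ->
  (forall k, (forall j, j \in s -> (j <= k)%N) ->
     a k <= \sum_(j <- s) N * a (k - j)%N) ->
  exists C, forall k, a k * t ^+ k <= C.
Proof.
move=> a0 N0 t0 s1 hs ha.
pose M := \max_(j <- s) j.
have sM j : j \in s -> (j <= M)%N by move=> js; exact: leq_bigmax_seq.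
(* [C] bounds the values up to index [M]. Beyond [M] the recursion applies, and it refers to smaller
   indices because all delays are at least 1. *)
pose C := \sum_(i < M.+1) a i * t ^+ i.
have b0 k : 0 <= a k * t ^+ k by rewrite mulr_ge0 // exprn_ge0 // ltW.
have C0 : 0 <= C by apply: sumr_ge0.
exists C; elim/ltn_ind => k IHk.
have [kM|Mk] := leqP k M.
  by rewrite /C (bigD1 (Ordinal (kM : (k < M.+1)%N))) //= lerDl sumr_ge0.
have : a k <= \sum_(j <- s) N * a (k - j)%N.
  by apply: ha => j /sM jM; apply: leq_trans jM (ltnW Mk).
move/(ler_wpM2r (exprn_ge0 k (ltW t0)))/le_trans; apply.
rewrite mulr_suml; apply: (@le_trans _ _ (\sum_(j <- s) C * (N * t ^+ j))).
  rewrite [leLHS]big_seq [leRHS]big_seq; apply: ler_sum => j js.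
  have j1 := allP s1 _ js; have jk : (j <= k)%N.
    by rewrite (leq_trans (sM _ js)) // ltnW.
  have -> : N * a (k - j)%N * t ^+ k = a (k - j)%N * t ^+ (k - j)%N * (N * t ^+ j).
    by rewrite -[in LHS](subnK jk) exprD addnK; ring.
  apply: ler_wpM2r; first by rewrite mulr_ge0 // exprn_ge0 // ltW.
  by apply: IHk; rewrite ltn_subrL j1 (leq_trans j1 jk).
by rewrite -mulr_sumr -mulr_sumr -[leRHS]mulr1 ler_wpM2l.
Qed.

End RealSequences.

(** * Packing, and covers of null sets *)

Section Packing.
Variables (R : realType) (l : nat).
Implicit Types (A : set 'rV[R]_l).

(* The points lie in the cube of centre y and side 2 b, which is cut into cells of
   side rho; each cell contains at most one of them. *)
Lemma card_separated (T : finType) (A : {set T}) (p : T -> 'rV[R]_l) y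
    (rho b : R) : 0 < rho -> 0 < b ->
  (forall w, w \in A -> `|y - p w| < b) ->
  (forall v w, v \in A -> w \in A -> `|p v - p w| < rho -> v = w) ->
  (#|A| <= (Num.trunc (2 * b / rho)).+1 ^ l)%N.
Proof.
move=> rho0 b0 pb psep; set m := Num.trunc _.
(* Coordinate [i] measured from the lower corner of the cube in units of [rho]; its integer part
   numbers the cell. *)
pose q w i := (p w ord0 i - y ord0 i + b) / rho.
have qb w i : w \in A -> 0 <= q w i < 2 * b / rho.
  move=> wA; have := le_lt_trans (coord_le_mx_norm _ i) (pb w wA).
  rewrite !mxE ltr_norml => /andP[h1 h2]; rewrite /q.
  by rewrite divr_ge0 ?(ltW rho0) /= ?ltr_pM2r ?invr_gt0 //; lra.
have qm w i : w \in A -> (Num.trunc (q w i) < m.+1)%N.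
  by move=> /(qb _ i) /andP[_ h]; rewrite ltnS /m le_truncn // ltW.
pose G w : {ffun 'I_l -> 'I_m.+1} := [ffun i => inord (Num.trunc (q w i))].
rewrite -[X in (X ^ l)%N]card_ord -[X in (_ ^ X)%N](card_ord l) -card_ffun.
rewrite -(card_in_imset (f := G)) ?max_card // => v w vA wA /ffunP Gvw.
apply: psep => //; apply: mx_norm_lt => // i.
have := Gvw i; rewrite !ffunE => /(congr1 val) /=.
rewrite !inordK ?qm // => qE.
have /andP[v0 _] := qb v i vA; have /andP[w0 _] := qb w i wA.
have /andP[v1 v2] := truncn_itv v0; have /andP[w1 w2] := truncn_itv w0.
have -> : (p v - p w) ord0 i = (q v i - q w i) * rho.
  by rewrite !mxE /q; field; rewrite gt_eqF.
rewrite normrM (gtr0_norm rho0) -[ltRHS]mul1r ltr_pM2r // ltr_norml.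
move: v1 v2 w1 w2; rewrite qE -!natr1; set z := _%:R => v1 v2 w1 w2.
by apply/andP; split; lra.
Qed.

End Packing.

(** * Hausdorff premeasures: finite covers and ball covers *)

Section Hausdorff.
Variables (R : realType) (l : nat).
Implicit Types (A E : set 'rV[R]_l) (s delta eps : R).
Local Open Scope ereal_scope.

Lemma diam_ge0 E : 0 <= diam E.
Proof. by apply: ereal_sup_ubound; left. Qed.

Lemma diam_le E (d : R) : (0 <= d)%R ->
  (forall x y, E x -> E y -> (enorm (x - y) <= d)%R) -> diam E <= d%:E.
Proof.
move=> d0 h; apply: ge_ereal_sup => _ [->|[[x y] /= [Ex Ey] <-]].
  by rewrite lee_fin.
by rewrite lee_fin h.
Qed.

Lemma enorm_le_diam E x y : E x -> E y -> (enorm (x - y))%:E <= diam E.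
Proof. by move=> Ex Ey; apply: ereal_sup_ubound; right; exists (x, y). Qed.

Lemma hausdorff_weight_ge0 s E : 0 <= hausdorff_weight s E.
Proof. by rewrite /hausdorff_weight; case: pselect => p /=; rewrite ?poweR_ge0. Qed.

Lemma hausdorff_weight_le s E (d : R) : (0 <= s)%R -> (0 <= d)%R ->
  diam E <= d%:E -> hausdorff_weight s E <= (d `^ s)%:E.
Proof.
move=> s0 d0 dE; rewrite /hausdorff_weight; case: pselect => [p|p] /=.
  by rewrite lee_fin powR_ge0.
rewrite -poweR_EFin; apply: gt0_ler_poweR => //; rewrite in_itv /= leey andbT.
  exact: diam_ge0.
by rewrite lee_fin.
Qed.

Lemma hausdorff_premeasure_ge0 s delta A : 0 <= hausdorff_premeasure s delta A.
Proof.
apply: le_ereal_inf_tmp => _ [E _ <-]; apply: nneseries_ge0 => j _ _.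
exact: hausdorff_weight_ge0.
Qed.

Lemma hausdorff_weight0 s : hausdorff_weight s (set0 : set 'rV[R]_l) = 0.
Proof. by rewrite /hausdorff_weight; case: pselect. Qed.

Lemma hausdorff_premeasure_le_finite s delta A (T : eqType) (r : seq T)
    (F : T -> set 'rV[R]_l) (d : R) : (0 <= s)%R -> (0 <= d <= delta)%R ->
  (forall t, diam (F t) <= d%:E) ->
  (forall x, A x -> exists2 t, t \in r & F t x) ->
  hausdorff_premeasure s delta A <= ((size r)%:R * d `^ s)%:E.
Proof.
move=> s0 /andP[d0 dd] dF cF.
(* The default [set0] extends the finite list to a sequence whose tail has weight 0. *)
pose E := nth set0 (map F r).
have dE j : diam (E j) <= d%:E.
  rewrite /E; elim: r j {cF E} => [|t r IHr] [|j] //=;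
  by apply: diam_le.
apply: ge_ereal_inf.
exists (\sum_(0 <= j <oo) hausdorff_weight s (E j)); first exists E => //.
  split=> [x /cF[t tr Ftx]|j]; last by apply: le_trans (dE j) _; rewrite lee_fin.
  by exists (index t r) => //; rewrite /E (nth_map t) ?index_mem // nth_index.
rewrite (nneseries_split 0 (size r)); last by move=> *; exact: hausdorff_weight_ge0.
rewrite add0n [X in _ + X]eseries0 ?adde0; last first.
  by move=> j rj _; rewrite /E nth_default ?size_map // hausdorff_weight0.
apply: (@le_trans _ _ (\sum_(0 <= j < size r) (d `^ s)%:E)).
  by apply: lee_sum => j _; apply: hausdorff_weight_le.
by rewrite sumEFin lee_fin sumr_const_nat subn0 mulr_natl.
Qed.

(** Lets a set of diameter [d] be enclosed in an open ball of radius [r] at extra cost at most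
    [eps]. For [s > 0] the radius is kept below the solution [q] of [q]^ s = d [^ s + eps]; for
    [s = 0] both powers are 1. *)
Lemma powR_upper_approx (s d delta eps : R) :
  (0 <= s -> 0 <= d < delta -> 0 < eps ->
   exists2 r, d < r < delta & r `^ s <= d `^ s + eps)%R.
Proof.
move=> s0 /andP[d0 dd] e0.
have [s00|sN0] := eqVneq s 0%R.
  exists ((d + delta) / 2)%R; first by apply/andP; split; lra.
  by rewrite s00 !powRr0 lerDl ltW.
have sp : (0 < s)%R by rewrite lt_neqAle eq_sym sN0.
pose q := ((d `^ s + eps) `^ s^-1)%R.
have qs : (q `^ s = d `^ s + eps)%R.
  by rewrite -powRrM mulVf // powRr1 // addr_ge0 ?powR_ge0 // ltW.
have dq : (d < q)%R.
  rewrite ltNge; apply/negP => qd.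
  have : (q `^ s <= d `^ s)%R by apply: ge0_ler_powR; rewrite // nnegrE powR_ge0.
  by rewrite qs gerDl leNgt e0.
exists (Num.min q ((d + delta) / 2))%R.
  by rewrite lt_min gt_min dq /=; apply/andP; split; [lra|apply/orP; right; lra].
rewrite -qs; apply: ge0_ler_powR; rewrite ?nnegrE ?ge_min ?lexx ?powR_ge0 //.
by rewrite le_min powR_ge0 /=; lra.
Qed.

(** Take a countable cover of total weight below [eps / 2] and enclose each nonempty [E j] in an
    open ball about one of its points, of radius slightly above its diameter. The extra costs form a
    geometric series of sum [eps / 2], and compactness leaves finitely many balls. They are sup-norm
    balls, which contain the Euclidean ones. *)
Lemma hausdorff_null_ball_cover s A delta eps :
  (0 <= s)%R -> (0 < delta)%R -> (0 < eps)%R -> compact A ->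
  hausdorff_measure s A = 0 ->
  exists B : seq ('rV[R]_l * R),
    [/\ forall x, A x -> exists2 b, b \in B & ball b.1 b.2 x,
        forall b, b \in B -> (0 < b.2 < delta)%R &
        (\sum_(b <- B) b.2 `^ s < eps)%R].
Proof.
move=> s0 delta0 eps0 cA HA.
have [E [AE Edelta] sumE] : exists2 E, hausdorff_cover (delta / 2) A E &
    \sum_(0 <= j <oo) hausdorff_weight s (E j) < (eps / 2)%:E.
  have [_ [E EA <-] sumE] : exists2 y, [set \sum_(0 <= j <oo) hausdorff_weight s (E j)
      | E in hausdorff_cover (delta / 2) A] y & y < (eps / 2)%:E.
    apply: ereal_inf_lt; apply: (@le_lt_trans _ _ 0); last by rewrite lte_fin divr_gt0.
    rewrite -[leRHS]HA; apply: ereal_sup_ubound; exists (delta / 2)%R => //=.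
    exact: divr_gt0.
  by exists E.
have pick j : exists b : 'rV[R]_l * R, E j !=set0 ->
    [/\ E j b.1, diam (E j) < b.2%:E, (0 < b.2 < delta)%R &
        (b.2 `^ s)%:E <= hausdorff_weight s (E j) + (eps / 2 / (2 ^ j.+1)%:R)%:E].
  have [E0|/set0P [y Ey]] := eqVneq (E j) set0.
    by exists (0%R : 'rV[R]_l, 0%R); rewrite E0 => -[].
  have [d dE] : exists d, diam (E j) = d%:E.
    exists (fine (diam (E j))); rewrite fineK // ge0_fin_numE ?diam_ge0 //.
    by apply: le_lt_trans (Edelta j) _; rewrite ltry.
  have d0 : (0 <= d)%R by rewrite -lee_fin -dE diam_ge0.
  have dd : (d < delta)%R.
    by have := Edelta j; rewrite dE lee_fin; lra.
  have [||r /andP[dr rd] rs] := @powR_upper_approx s d delta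
      (eps / 2 / (2 ^ j.+1)%:R) s0.
  - by rewrite d0.
  - by rewrite divr_gt0 ?divr_gt0 // ltr0n expn_gt0.
  exists (y, r) => _; rewrite dE; split=> //.
    by rewrite rd (le_lt_trans d0 dr).
  rewrite /hausdorff_weight; case: pselect => [E0|_] /=.
    by move: Ey; rewrite E0.
  by rewrite dE poweR_EFin -EFinD lee_fin.
have [b hb] := boolp.choice pick.
pose D := [set j | E j !=set0].
have cov : A `<=` cover D (fun j => ball (b j).1 (b j).2).
  move=> x /AE [j _ Ejx]; have Dj : D j by exists x.
  exists j => //; have [Eb db _ _] := hb j Dj.
  rewrite -ball_normE /=; apply: le_lt_trans (mx_norm_le_enorm _) _.
  by rewrite -lte_fin; apply: le_lt_trans db; exact: enorm_le_diam.
have cA' : cover_compact A by rewrite -compact_cover.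
have [J JD AJ] := cA' _ _ _ (fun j _ => ball_open _ _) cov.
have {}JD j : j \in J -> D j by move=> /JD; apply: set_mem.
exists [seq b j | j <- J]; split.
- by move=> x /AJ [j /= Jj bx]; exists (b j) => //; exact: map_f.
- by move=> _ /mapP [j /JD Dj ->]; have [] := hb j Dj.
rewrite big_map -lte_fin -sumEFin.
pose M := (\max_(j <- J) j).+1.
(* The terms are nonnegative, so the sum over [J] is at most the sum over the initial segment
   containing [J]. *)
apply: (@le_lt_trans _ _ (\sum_(0 <= j < M)
    (hausdorff_weight s (E j) + (eps / 2 / (2 ^ j.+1)%:R)%:E))).
  have g0 j : 0 <= hausdorff_weight s (E j) + (eps / 2 / (2 ^ j.+1)%:R)%:E.
    rewrite adde_ge0 ?hausdorff_weight_ge0 // lee_fin divr_ge0 //.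
    by rewrite divr_ge0 // ltW.
  apply: (@le_trans _ _ (\sum_(j <- J)
      (hausdorff_weight s (E j) + (eps / 2 / (2 ^ j.+1)%:R)%:E))).
    rewrite big_seq [leRHS]big_seq; apply: lee_sum => j /JD Dj.
    by have [] := hb j Dj.
  rewrite big_mkord.
  rewrite [leRHS](bigID (fun j : 'I_M => val j \in J)) /=.
  apply: (@le_trans _ _ (\sum_(i < M | val i \in J)
      (hausdorff_weight s (E i) + (eps / 2 / (2 ^ i.+1)%:R)%:E))); last first.
    by rewrite leeDl //; apply: sume_ge0 => i _; exact: g0.
  rewrite -(big_mkord (fun i => i \in J) (fun i =>
      (hausdorff_weight s (E i) + (eps / 2 / (2 ^ i.+1)%:R)%:E))).
  suff pJ : perm_eq [seq i <- index_iota 0 M | i \in J] J.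
    by rewrite -[leRHS]big_filter (perm_big _ pJ).
  apply: uniq_perm; [exact/filter_uniq/iota_uniq | exact: fset_uniq |].
  move=> j; rewrite mem_filter mem_index_iota /=.
  have [Jj|//] := boolP (j \in J); rewrite /= ltnS.
  by apply: (@leq_bigmax_seq _ _ _ id).
apply: (@le_lt_trans _ _ (\sum_(0 <= j <oo)
    (hausdorff_weight s (E j) + (eps / 2 / (2 ^ j.+1)%:R)%:E))).
  apply: nneseries_lim_ge => j _ _.
  rewrite adde_ge0 ?hausdorff_weight_ge0 // lee_fin divr_ge0 //.
  by rewrite divr_ge0 // ltW.
apply: (@le_lt_trans _ _ (\sum_(0 <= j <oo) hausdorff_weight s (E j) + (eps / 2)%:E)).
  by apply: epsilon_trick => [j|]; [exact: hausdorff_weight_ge0|rewrite divr_ge0 // ltW].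
have -> : eps%:E = (eps / 2)%:E + (eps / 2)%:E by rewrite -EFinD -splitr.
by rewrite lteD2rE.
Qed.

End Hausdorff.

(** * The boundary of the attractor *)

(** The least [m] with [c ^+ m <= r] is at least 2 because [r < c]; take [k = m - 1]. *)
Lemma exp_scale (R : realType) (c r : R) : 0 < c < 1 -> 0 < r < c ->
  exists2 k, (1 <= k)%N & c ^+ k.+1 <= r < c ^+ k.
Proof.
move=> /andP[c0 c1] /andP[r0 rc].
have ex : exists m, c ^+ m <= r.
  have : geometric 1 c k @[k --> \oo] --> (0 : R).
    by apply: cvg_geometric; rewrite gtr0_norm.
  move/(cvgr_le _)/(_ _ r0) => [m _ /(_ m (leqnn m))] /=.
  by rewrite mul1r; exists m.
case: (ex_minnP ex) => m; case: m => [|[|k]] hm mmin.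
- by move: hm; rewrite expr0 leNgt (lt_trans rc c1).
- by move: hm; rewrite expr1 leNgt rc.
exists k.+1 => //; rewrite hm /= ltNge; apply/negP => /mmin.
by rewrite ltnn.
Qed.

Lemma bounded_enorm (R : realType) (l : nat) (A : set 'rV[R]_l) :
  bounded_set A -> exists2 D : R, 0 < D &
    forall x y, A x -> A y -> enorm (x - y) <= D.
Proof.
move=> /pinfty_ex_gt0 [M M0 hM]; exists (l.+1%:R * (M + M)).
  by rewrite mulr_gt0 ?addr_gt0.
move=> x y Ax Ay; apply: le_trans (enorm_le_mx_norm _) _.
rewrite ler_wpM2l //; apply: le_trans (ler_normB _ _) _.
by apply: lerD; [exact: hM x Ax|exact: hM y Ay].
Qed.

Lemma boundary_closed (T : topologicalType) (A : set T) : closed (boundary A).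
Proof. by apply: closedI; [exact: closed_closure | exact/open_closedC/open_interior]. Qed.

Lemma boundary_closedE (T : topologicalType) (A : set T) : closed A ->
  boundary A = A `\` interior A.
Proof. by rewrite /boundary => /closure_id <-. Qed.

(* At a point of A where the first coordinate is maximal, A has no interior. *)
Lemma compact_boundary_neq0 (R : realType) (l : nat) (A : set 'rV[R]_l) :
  (0 < l)%N -> compact A -> A !=set0 -> boundary A !=set0.
Proof.
move=> l0 cA A0; pose i0 := Ordinal l0.
have [|x xA xmax] := @EVT_max_rV R l (fun x => x ord0 i0) A A0 cA.
  by apply: continuous_subspaceT => x; exact: coord_continuous.
exists x; rewrite boundary_closedE; last first.
  by apply: compact_closed cA; exact: norm_hausdorff.
split; first exact: set_mem.
rewrite /interior /= nbhs_ballP => -[e /= e0 xe].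
(* A diagonal shift stays in the sup-norm ball and raises the first coordinate. *)
have : A (x + const_mx (e / 2)).
  apply: xe; rewrite -ball_normE /=; apply: mx_norm_lt => // i.
  by rewrite !mxE opprD addNKr normrN gtr0_norm ?divr_gt0 //; lra.
move=> /mem_set/xmax; rewrite !mxE; have : 0 < e / 2 by rewrite divr_gt0.
lra.
Qed.

(* The points f_w u, |w| = k, are c^k a-separated when the open set contains the
   ball of radius a around u. *)
Lemma osc_card_words_ball (R : realType) (l n : nat) (c : R)
    (f : 'I_n -> 'rV[R]_l -> 'rV[R]_l) (A : set 'rV[R]_l) : 0 < c ->
  (forall i, similitude c (f i)) -> open_set_condition f -> compact A ->
  exists N, forall k y,
    (#|[set w : k.-tuple 'I_n |
        `[< exists2 x, A x & ball y (c ^+ k) (word_map f w x) >]]%SET| <= N)%N.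
Proof.
move=> c0 hf [U [Uo _ [u Uu] fU Udis]] cA.
have [a /= a0 ua] : exists2 a : R, 0 < a & ball u a `<=` U.
  by move: Uo; rewrite openE => /(_ u Uu); rewrite /interior /= nbhs_ballP.
have [D D0 hD] : exists2 D : R, 0 < D &
    forall x y, (A `|` [set u]) x -> (A `|` [set u]) y -> enorm (x - y) <= D.
  by apply/bounded_enorm/compact_bounded/compactU => //; exact: compact_set1.
pose rho := a / l.+1%:R.
have rho0 : 0 < rho by rewrite divr_gt0.
exists ((Num.trunc (2 * (1 + D) / rho)).+1 ^ l)%N => k y.
have ck0 : 0 < c ^+ k by rewrite exprn_gt0.
(* Cube and cells both shrink by [c ^+ k], so the bound does not depend on [k]. *)
have -> : 2 * (1 + D) / rho = 2 * (c ^+ k * (1 + D)) / (c ^+ k * rho).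
  by field; rewrite !gt_eqF.
have sim w : size w = k -> similitude (c ^+ k) (word_map f w).
  by move=> <-; exact: word_map_similitude.
apply: (card_separated (p := fun w : k.-tuple 'I_n => word_map f w u) (y := y)).
- by rewrite mulr_gt0.
- by rewrite mulr_gt0 // addr_gt0.
- move=> w; rewrite inE => /asboolP[x Ax]; rewrite -ball_normE /= => yx.
  rewrite -(subrK (word_map f w x) y) -addrA mulrDr mulr1.
  apply: le_lt_trans (ler_normD _ _) _; apply: ltr_leD => //.
  apply: le_trans (mx_norm_le_enorm _) _; rewrite sim ?size_tuple //.
  by rewrite ler_pM2l // hD; [|left|right].
move=> v w _ _ vw; apply: val_inj => /=.
(* If the images of [u] under the words [v] and [w] are too close, the preimage [z] of the second
   under the map of [v] falls in the ball around [u], hence in [U], and disjointness forces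
   [v = w]. *)
have [z zE] := similitude_surj ck0 (sim v (size_tuple v)) (word_map f w u).
have Uz : U z.
  apply: ua; rewrite -ball_normE /=; apply: le_lt_trans (mx_norm_le_enorm _) _.
  rewrite -(ltr_pM2l ck0) -(sim v (size_tuple v)) zE.
  apply: le_lt_trans (enorm_le_mx_norm _) _.
  by rewrite mulrC -ltr_pdivlMr // -mulrA.
apply: (word_map_disjoint _ fU Udis _ Uz Uu zE); last by rewrite !size_tuple.
by move=> i; exact: similitude_inj c0 (hf i).
Qed.

Lemma card_bigcup_seq (T : finType) (I : eqType) (r : seq I) (A : {set T})
    (F : I -> {set T}) :
  (forall x, x \in A -> exists2 i, i \in r & x \in F i) ->
  (#|A| <= \sum_(i <- r) #|F i|)%N.
Proof.
elim: r A => [|i r IHr] A AF.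
  rewrite big_nil leqn0 cards_eq0; apply/eqP/setP => x; rewrite inE.
  by apply/negP => /AF[].
rewrite big_cons -(cardsID (F i) A); apply: leq_add.
  exact/subset_leq_card/finset.subsetIr.
apply: IHr => x; rewrite inE => /andP[xFi /AF[j]].
rewrite inE => /orP[/eqP ->|]; last by exists j.
by rewrite (negbTE xFi).
Qed.

(** * Growth of the boundary words and the two dimension bounds *)

Section BoundaryWords.
Variables (R : realType) (l n : nat) (c : R).
Variables (f : 'I_n -> 'rV[R]_l -> 'rV[R]_l) (K : set 'rV[R]_l).
Hypotheses (l0 : (0 < l)%N) (c0 : 0 < c) (c1 : c < 1).
Hypothesis hf : forall i, similitude c (f i).
Hypothesis hK : is_attractor f K.

Let Kcompact : compact K. Proof. by case: hK. Qed.
Let Kclosed : closed K. 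
Proof. by apply: compact_closed Kcompact; exact: norm_hausdorff. Qed.
Let KE : K = \bigcup_i (f i @` K). Proof. by case: hK. Qed.
Let fK : \bigcup_i (f i @` K) `<=` K. Proof. by rewrite -KE. Qed.

Lemma attractor_boundary_compact : compact (boundary K).
Proof.
apply: subclosed_compact Kcompact _; first exact: boundary_closed.
by rewrite boundary_closedE //; exact: subDsetl.
Qed.

(** Contrapositive: the map of [w] sends [K] into [K], hence interior points of [K] to interior
    points. *)
Lemma attractor_boundary_pullback w x : K x ->
  boundary K (word_map f w x) -> boundary K x.
Proof.
rewrite boundary_closedE // => Kx [_ nwx]; split=> // Kox; apply: nwx.
have hw := word_map_similitude w hf.
apply: (similitude_interior (exprn_gt0 _ c0) hw (word_map_sub fK)).
by exists x.
Qed.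

Lemma boundary_wordsP k (w : k.-tuple 'I_n) :
  reflect (exists2 x, K x & boundary K (word_map f w x))
          (w \in boundary_words f K k).
Proof.
rewrite inE; apply: (iffP (asboolP _)) => [[_ [[x Kx <-] bx]]|[x Kx bx]].
  by exists x.
by exists (word_map f w x); split=> //; exists x.
Qed.

(** For a boundary point reached from [x] through [v] and then [u], the intermediate point is a
    witness for [u]; pulled back along [u] it lies on the boundary, so [x] is a witness for [v]. *)
Lemma boundary_words_cat j m (u : j.-tuple 'I_n) (v : m.-tuple 'I_n) :
  [tuple of u ++ v] \in boundary_words f K (j + m) ->
  u \in boundary_words f K j /\ v \in boundary_words f K m.
Proof.
move=> /boundary_wordsP[x Kx]; rewrite /= word_map_cat => bx.
have Kvx : K (word_map f v x) by apply: (word_map_sub fK); exists x.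
split; apply/boundary_wordsP; first by exists (word_map f v x).
by exists x => //; exact: attractor_boundary_pullback bx.
Qed.

Lemma boundary_words_cover k x : boundary K x ->
  exists2 w, w \in boundary_words f K k & (word_map f w @` K) x.
Proof.
move=> bx; have Kx : K x by move: bx; rewrite boundary_closedE // => -[].
have [w [y Ky yx]] := word_map_cover k KE Kx.
exists w; last by exists y.
by apply/boundary_wordsP; exists y => //; rewrite yx.
Qed.

Lemma boundary_words_gt0 k : (0 < #|boundary_words f K k|)%N.
Proof.
have [_ K0 _] := hK.
have [x /(boundary_words_cover k)[w wA _]] := compact_boundary_neq0 l0 Kcompact K0.
by apply/card_gt0P; exists w.
Qed.

Let a k : R := #|boundary_words f K k|%:R.

Let a_gt0 k : 0 < a k. Proof. by rewrite ltr0n boundary_words_gt0. Qed.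

Lemma boundary_words_ln_growth :
  exists L : R, ln (a k) / k%:R @[k --> \oo] --> L.
Proof.
apply: fekete => [k|j m]; first by rewrite ln_ge0 // ler1n boundary_words_gt0.
rewrite -lnM ?posrE // ler_ln ?posrE ?mulr_gt0 //.
by rewrite -natrM ler_nat card_words_cat //; exact: boundary_words_cat.
Qed.

Lemma boundary_growth_cvg (L : R) : ln (a k) / k%:R @[k --> \oo] --> L ->
  boundary_growth f K k @[k --> \oo] --> expR L.
Proof.
move=> aL; have -> : boundary_growth f K = fun k => expR (ln (a k) / k%:R).
  by apply/funext => k; rewrite /boundary_growth /powR gt_eqF ?a_gt0 // mulrC.
by apply: continuous_cvg => //; exact: continuous_expR.
Qed.

(** The pieces of level [k] bound the premeasure by [a k] times the [s]-th power of [c ^+ k * D],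
    whose logarithm is asymptotic to [k * (L + s * ln c)] and tends to minus infinity. *)
Lemma boundary_hausdorff_measure_eq0 (L s : R) :
  ln (a k) / k%:R @[k --> \oo] --> L -> 0 <= s -> L + s * ln c < 0 ->
  hausdorff_measure s (boundary K) = 0%E.
Proof.
move=> aL s0 Ls.
have [D D0 hD] := bounded_enorm (compact_bounded Kcompact).
have lnc : ln c < 0 by rewrite ln_lt0 // c0.
have diamW k (w : k.-tuple 'I_n) :
    (diam (word_map f w @` K) <= (c ^+ k * D)%:E)%E.
  apply: diam_le; first by rewrite mulr_ge0 ?exprn_ge0 // ltW.
  move=> _ _ [x Kx <-] [y Ky <-]; rewrite (word_map_similitude w hf) size_tuple.
  by rewrite ler_wpM2l ?hD // exprn_ge0 // ltW.
apply/eqP; rewrite eq_le; apply/andP; split; last first.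
  apply: le_ereal_sup_tmp; exists (hausdorff_premeasure s 1 (boundary K)).
    by exists 1 => //=.
  exact: hausdorff_premeasure_ge0.
apply: ge_ereal_sup => _ [delta /= delta0 <-].
apply/lee_addgt0Pr => e e0; rewrite add0e.
have scale k : c ^+ k * D = expR (k%:R * ln c + ln D).
  by rewrite expRD expRM_natl !lnK ?posrE.
(* Half of the gap [g] pays for the deviation of [ln (a k) / k] from [L], the other half for the
   constants [D] and [e]. *)
pose g := - (L + s * ln c).
have g0 : 0 < g by rewrite oppr_gt0.
have : \forall k \near \oo, [/\ ln (a k) / k%:R < L + g / 2, (0 < k)%N,
    (s * ln D - ln e) / (g / 2) < k%:R & (ln D - ln delta) / - ln c < k%:R].
  near=> k; split; near: k.
  - by apply: (cvgr_lt _ aL); rewrite ltrDl divr_gt0.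
  - exact: nbhs_infty_gt.
  - exact: nbhs_infty_gtr.
  - exact: nbhs_infty_gtr.
move=> [k _ /(_ k (leqnn k))] /= [h1 k0 h2 h3].
have k0' : 0 < k%:R :> R by rewrite ltr0n.
apply: le_trans (hausdorff_premeasure_le_finite (r := enum (boundary_words f K k))
  s0 _ (diamW k) _) _.
- rewrite mulr_ge0 ?exprn_ge0 ?(ltW c0) ?(ltW D0) //= scale.
  rewrite -[leRHS]lnK ?posrE // ler_expR.
  by move: h3; rewrite ltr_pdivrMr ?oppr_gt0 //; lra.
- move=> x /(boundary_words_cover k)[w wA wx]; exists w => //.
  by rewrite mem_enum.
rewrite lee_fin -cardE -/(a k) scale -expRM -[a k]lnK ?posrE // -expRD.
rewrite -[leRHS]lnK ?posrE // ler_expR.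
move: h1 h2; rewrite ltr_pdivrMr // ltr_pdivrMr ?divr_gt0 // /g => h1 h2.
suff : (L + - (L + s * ln c) / 2) * k%:R + k%:R * (- (L + s * ln c) / 2)
   = - (k%:R * s * ln c) by lra.
by field.
Unshelve. all: by end_near. Qed.

Lemma boundary_growth_le (L s : R) : open_set_condition f ->
  ln (a k) / k%:R @[k --> \oo] --> L -> 0 <= s ->
  hausdorff_measure s (boundary K) = 0%E -> L <= - (s * ln c).
Proof.
move=> hosc aL s0 Hs.
have [N hN] := osc_card_words_ball c0 hf hosc Kcompact.
pose t := c `^ s.
have t0 : 0 < t by rewrite powR_gt0.
(* Radii below [c] give levels at least 1. As [c ^+ k.+1 <= r] loses one factor [t], this [eps]
   makes the sum of the [t ^+ kk b.2] at most [1 / (N + 1)]. *)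
have [|B [cB rB sB]] := hausdorff_null_ball_cover
    (delta := c) (eps := t / N.+1%:R) s0 c0 _ attractor_boundary_compact Hs.
  by rewrite divr_gt0.
have scale r : exists k, 0 < r < c -> (1 <= k)%N /\ c ^+ k.+1 <= r < c ^+ k.
  have [rc|] := boolP (0 < r < c); last by exists 0%N.
  by have [||k k1 hk] := @exp_scale R c r; rewrite ?c0 //; exists k.
have [kk hkk] := boolp.choice scale.
pose js := [seq kk b.2 | b <- B].
pose F (b : 'rV[R]_l * R) k : {set k.-tuple 'I_n} := [set w : k.-tuple 'I_n |
  `[< exists2 x, K x & boundary K (word_map f w x) /\ ball b.1 b.2 (word_map f w x) >]]%SET.
(* A prefix of length [j] has its piece meeting the ball [b], whose radius is below [c ^+ j]: at
   most [N] choices. The rest is a boundary word of length [m]. *)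
have cardF b j m : b \in B -> j = kk b.2 ->
    (#|F b (j + m)%N| <= N * #|boundary_words f K m|)%N.
  move=> bB jE; apply: leq_trans (leq_mul (hN j b.1) (leqnn _)).
  apply: card_words_cat => u v; rewrite inE => /asboolP[x Kx [bx yx]].
  have [_ vA] : u \in boundary_words f K j /\ v \in boundary_words f K m.
    by apply: boundary_words_cat; apply/boundary_wordsP; exists x.
  split=> //; rewrite inE; apply/asboolP; exists (word_map f v x).
    by apply: (word_map_sub fK); exists x.
  rewrite -word_map_cat; apply: le_ball yx.
  by have [_ /andP[_ /ltW]] := hkk _ (rB b bB); rewrite jE.
have [C hC] : exists C, forall k, a k * t ^+ k <= C.
  apply: (@renewal_bound R a N%:R t js) => //.
  - by apply/allP => _ /mapP[b bB ->]; have [] := hkk _ (rB b bB).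
  - rewrite big_map.
    have : \sum_(b <- B) t ^+ kk b.2 <= N.+1%:R^-1.
      rewrite -(ler_pM2r t0) mulrC [leRHS]mulrC mulr_sumr.
      apply: le_trans (ltW sB); rewrite big_seq [leRHS]big_seq.
      apply: ler_sum => b bB; have [_ /andP[h _]] := hkk _ (rB b bB).
      rewrite -exprS /t -powR_mulrn ?powR_ge0 // -powRrM mulrC powRrM.
      rewrite powR_mulrn ?(ltW c0) //; apply: ge0_ler_powR => //.
        by rewrite nnegrE exprn_ge0 // ltW.
      by rewrite nnegrE; have /andP[/ltW] := rB b bB.
    move/(ler_wpM2l (ler0n R N))/le_trans; apply.
    by rewrite ler_pdivrMr // mul1r ler_nat.
  move=> k hk; rewrite big_map.
  have : (#|boundary_words f K k| <= \sum_(b <- B) #|F b k|)%N.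
    apply: card_bigcup_seq => w /boundary_wordsP[x Kx bx].
    have [b bB yx] := cB _ bx; exists b => //.
    by rewrite inE; apply/asboolP; exists x.
  rewrite /a -(ler_nat R) => /le_trans; apply; rewrite natr_sum.
  rewrite big_seq [leRHS]big_seq; apply: ler_sum => b bB.
  rewrite -natrM ler_nat.
  have /hk jk : kk b.2 \in js by apply: map_f.
  by have := cardF b (kk b.2) (k - kk b.2)%N bB erefl; rewrite subnKC.
have C0 : 0 < C by apply: lt_le_trans (hC 0%N); rewrite mulr_gt0 // exprn_gt0.
have lnt : ln t = s * ln c by rewrite ln_powR.
rewrite leNgt; apply/negP => Lt.
(* If [g] were positive, [a k * t ^+ k] would eventually exceed [expR (k%:R * g / 2)], and thus
   [C]. *)
pose g := L + s * ln c.
have g0 : 0 < g by rewrite /g; lra.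
have : \forall k \near \oo, [/\ L - g / 2 < ln (a k) / k%:R, (0 < k)%N &
    ln C / (g / 2) < k%:R].
  near=> k; split; near: k.
  - by apply: (cvgr_gt _ aL); rewrite ltrBlDr ltrDl divr_gt0.
  - exact: nbhs_infty_gt.
  - exact: nbhs_infty_gtr.
move=> [k _ /(_ k (leqnn k))] /= [h1 k0 h2].
have k0' : 0 < k%:R :> R by rewrite ltr0n.
have := hC k.
rewrite -ler_ln ?posrE ?mulr_gt0 ?exprn_gt0 // lnM ?posrE ?exprn_gt0 // lnXn //.
rewrite lnt -mulr_natl.
move: h1 h2; rewrite ltr_pdivlMr // ltr_pdivrMr ?divr_gt0 // /g => h1 h2 h3.
suff : (L - (L + s * ln c) / 2) * k%:R
   = k%:R * ((L + s * ln c) / 2) - k%:R * (s * ln c) by lra.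
by field.
Unshelve. all: by end_near. Qed.

(** Every [s] above [- (L / ln c)] has measure zero, and every [s >= 0] of measure zero is at least
    this value. *)
Lemma boundary_hausdorff_dim (L : R) : open_set_condition f ->
  ln (a k) / k%:R @[k --> \oo] --> L ->
  hausdorff_dim (boundary K) = (- (L / ln c))%:E.
Proof.
move=> hosc aL; have lnc : ln c < 0 by rewrite ln_lt0 // c0.
(* Every [a k] is at least 1; hence the exponents tested below are nonnegative, as [hausdorff_dim]
   demands. *)
have L0 : 0 <= L.
  apply: (cvgr_to_ge aL); near=> k.
  by rewrite divr_ge0 // ln_ge0 // ler1n boundary_words_gt0.
have dimE s : - (L / ln c) < s -> L + s * ln c < 0.
  by rewrite -mulrN -invrN ltr_pdivrMr ?oppr_gt0 //; lra.
have dim0 : 0 <= - (L / ln c) by rewrite -mulrN -invrN divr_ge0 // oppr_ge0 ltW.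
apply/eqP; rewrite eq_le; apply/andP; split.
  apply/lee_addgt0Pr => e e0; apply: ge_ereal_inf.
  exists (- (L / ln c) + e)%:E => //.
  have se : 0 <= - (L / ln c) + e by rewrite addr_ge0 // ltW.
  exists (- (L / ln c) + e) => //; split => //.
  by apply: (boundary_hausdorff_measure_eq0 aL) => //; apply: dimE; rewrite ltrDl.
apply: le_ereal_inf_tmp => _ [s /= [s0 Hs] <-].
rewrite lee_fin -mulrN -invrN ler_pdivrMr ?oppr_gt0 // mulrN.
exact: boundary_growth_le.
Unshelve. all: by end_near. Qed.

End BoundaryWords.

Unset Implicit Arguments.
Set Strict Implicit.

Theorem mainTheorem4 (R : realType) (l n : nat) (c : R)
    (f : 'I_n -> 'rV[R]_l -> 'rV[R]_l) (K : set 'rV[R]_l)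
    (hl : (0 < l)%N) (hc0 : 0 < c) (hc1 : c < 1)
    (hf : forall i, similitude c (f i))
    (hosc : open_set_condition f)
    (hK : is_attractor f K) :
  exists2 alpha : R,
    boundary_growth f K k @[k --> \oo] --> alpha &
    hausdorff_dim (boundary K) = (- (ln alpha / ln c))%:E.
Proof.
have [L aL] := boundary_words_ln_growth hl hc0 hf hK.
exists (expR L); first exact: (boundary_growth_cvg hl hK).
by rewrite expRK; exact: (boundary_hausdorff_dim hl hc0 hc1 hf hK).
Qed.
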